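(* Let $M$ be a compact connected manifold and let $\mathcal{F}$ be a continuous codimension one foliation on $M$ which is tangent or transverse to the boundaries. The following are equivalent: 1) $\mathcal{F}$ is pointwise almost periodic. 2) $\mathcal{F}$ is $R$-closed. 3) $\mathcal{F}$ is minimal or compact.
   Context: $M$ may have boundary; $\mathcal{F}$ is identified with the decomposition of $M$ into its leaves, and $L_x$ denotes the leaf through $x$. $\mathcal{F}$ is pointwise almost periodic if the relation $\{(x,y)\in M\times M\mid y\in\overline{L_x}\}$ is an equivalence relation on $M$ (equivalently, the leaf closures form a partition of $M$). $\mathcal{F}$ is $R$-closed if this relation is a closed subset of $M\times M$. $\mathcal{F}$ is minimal if every leaf is dense in $M$. $\mathcal{F}$ is compact if every leaf is compact. *)

(* Defs.v *)
From HB Require Import structures.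
From Stdlib Require Export Relations.
From mathcomp Require Export all_boot all_order all_algebra.
From mathcomp Require Export all_classical reals topology normedtype.
Export Order.TTheory GRing.Theory Num.Theory.
Export numFieldNormedType.Exports.

Set Implicit Arguments.
Unset Strict Implicit.
Unset Printing Implicit Defensive.

Local Open Scope classical_set_scope.
Local Open Scope ring_scope.

(* The dimension of the manifold is n.+1: a codimension one foliation needs
   dimension at least 1.  Leaves have dimension n. *)

Definition half_space (R : realType) (n : nat) (i : 'I_n.+1) :
  set 'rV[R]_n.+1 := [set v | 0 <= v 0 i].

(* A homeomorphism from an open subset of M onto a relatively open subset of a
   half-space.  Any coordinate may be the one that defines the half-space, so
   that the last coordinate can be kept for the direction transverse to a
   foliation, see [foliation].  The values of chart_map and chart_inv off
   chart_dom and chart_cod are irrelevant. *)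
Record chart (R : realType) (n : nat) (M : topologicalType) := Chart {
  chart_axis : 'I_n.+1;
  chart_dom : set M;
  chart_cod : set 'rV[R]_n.+1;
  chart_map : M -> 'rV[R]_n.+1;
  chart_inv : 'rV[R]_n.+1 -> M;
  chart_dom_open : open chart_dom;
  chart_cod_open : exists2 O : set 'rV[R]_n.+1,
    open O & chart_cod = half_space chart_axis `&` O;
  chart_mapP : forall x, chart_dom x -> chart_cod (chart_map x);
  chart_invP : forall v, chart_cod v -> chart_dom (chart_inv v);
  chart_mapK : forall x, chart_dom x -> chart_inv (chart_map x) = x;
  chart_invK : forall v, chart_cod v -> chart_map (chart_inv v) = v;
  chart_map_cont : {within chart_dom, continuous chart_map};
  chart_inv_cont : {within chart_cod, continuous chart_inv} }.

Definition manifold (R : realType) (n : nat) (M : topologicalType) : Prop :=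
  [/\ hausdorff_space M, @second_countable M &
      forall x : M, exists c : chart R n M, chart_dom c x].

Definition chart_boundary (R : realType) (n : nat) (M : topologicalType)
    (c : chart R n M) : set M :=
  chart_dom c `&` [set x | chart_map c x 0 (chart_axis c) = 0].

Definition manifold_boundary (R : realType) (n : nat) (M : topologicalType) :
  set M := [set x | exists c : chart R n M, chart_boundary c x].

Definition height (R : realType) (n : nat) (M : topologicalType)
  (c : chart R n M) (x : M) : R := chart_map c x 0 ord_max.

(* Foliated atlases: the transition maps have the form
   (u, t) |-> (g (u, t), h t), locally at every point.  *)
Record foliation (R : realType) (n : nat) (M : topologicalType) := Foliation {
  fol_atlas : set (chart R n M);
  fol_cover : forall x : M, exists2 c, fol_atlas c & chart_dom c x;
  fol_compat : forall (c d : chart R n M) (x : M),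
    fol_atlas c -> fol_atlas d -> chart_dom c x -> chart_dom d x ->
    exists h : R -> R, \forall y \near x, height d y = h (height c y) }.

(* Near the points of chart_boundary c, the boundary of M is a level set of the
   height when chart_axis c = ord_max (tangent case), and it cuts across the
   level sets, which are half-spaces of dimension n there, when
   chart_axis c != ord_max (transverse case). *)
Definition tangent_along (R : realType) (n : nat) (M : topologicalType)
    (F : foliation R n M) (B : set M) : Prop :=
  forall x, B x -> exists c : chart R n M,
    [/\ fol_atlas F c, chart_boundary c x & chart_axis c = ord_max].

Definition transverse_along (R : realType) (n : nat) (M : topologicalType)
    (F : foliation R n M) (B : set M) : Prop :=
  forall x, B x -> exists c : chart R n M,
    [/\ fol_atlas F c, chart_boundary c x & chart_axis c <> ord_max].

Definition tangent_or_transverse (R : realType) (n : nat)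
    (M : topologicalType) (F : foliation R n M) : Prop :=
  forall x, @manifold_boundary R n M x ->
    let B := connected_component (@manifold_boundary R n M) x in
    tangent_along F B \/ transverse_along F B.

Definition plaque (R : realType) (n : nat) (M : topologicalType)
    (c : chart R n M) (x : M) : set M :=
  connected_component
    (chart_dom c `&` [set y | height c y = height c x]) x.

Definition same_plaque (R : realType) (n : nat) (M : topologicalType)
    (F : foliation R n M) (x y : M) : Prop :=
  exists2 c, fol_atlas F c & plaque c x y.

(* Two points are in the same leaf when a finite chain of plaques joins them. *)
Definition leaf (R : realType) (n : nat) (M : topologicalType)
    (F : foliation R n M) (x : M) : set M :=
  [set y | clos_refl_sym_trans M (same_plaque F) x y].

Definition closure_relation (R : realType) (n : nat) (M : topologicalType)
    (F : foliation R n M) : relation M :=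
  fun x y => closure (leaf F x) y.

Definition pointwise_almost_periodic (R : realType) (n : nat)
    (M : topologicalType) (F : foliation R n M) : Prop :=
  equivalence M (closure_relation F).

Definition R_closed (R : realType) (n : nat) (M : topologicalType)
    (F : foliation R n M) : Prop :=
  closed [set z : M * M | closure_relation F z.1 z.2].

Definition minimal_foliation (R : realType) (n : nat) (M : topologicalType)
    (F : foliation R n M) : Prop :=
  forall x, dense (leaf F x).

Definition compact_foliation (R : realType) (n : nat) (M : topologicalType)
    (F : foliation R n M) : Prop :=
  forall x, compact (leaf F x).

(* Main.v *)
Require Import Defs.
From mathcomp Require Import lra.

Set Implicit Arguments.
Unset Strict Implicit.
Unset Printing Implicit Defensive.

Local Open Scope classical_set_scope.
Local Open Scope ring_scope.

(** Pointwise almost periodicity is what has to be exploited: a closed relation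
of the form y \in closure (leaf x) is symmetric and transitive by passing to
limits ([R_closed_almost_periodic]), and for minimal or compact foliations the
relation is either total or the leaf relation.

So assume that leaf closures form a partition, and let K be the closure of a
leaf, K <> M.  Then K is closed and saturated, every leaf in K is dense in K,
and K has empty interior, because the interior of a saturated set is saturated
and M is connected.  Cover M by finitely many flow boxes: open sets B with a
height h whose level sets lie in leaves.  For a small d, compactness gives a
finite union S of leaf closures disjoint from K which is so rich that, in each
box, every interval of heights of length at least d contains the height of a
point of S ([fine_separator]).  In each box S cuts the heights into short
intervals, and those which contain a height of K define thin strips of the box.
The overlaps of the boxes contain sub-boxes taller than d ([uniform_near]); so
a strip of one box is carried across the whole overlap to a strip of the other
box, with S still at its ends.  This has two consequences.

- The union of the strips is a saturated neighborhood of K, which can be made as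
  small as desired ([tube_saturated], [saturated_neighborhood]).  As closures of
  leaves are compact, the relation is then closed
  ([almost_periodic_R_closed]).

- Call a point of K exposed when an interval of heights leads from it to S
  without meeting K again: it lies on an extremal plaque of K in its strip.
  Being exposed passes from box to box ([exposed_transfer]), so the exposed
  points form a saturated set; there are at most two exposed heights per strip,
  so this set is closed and its plaques are isolated from each other
  ([exposed_isolated]).  It is nonempty if S was made to meet a suitable gap of
  K ([exposed_near]).  Leaves being dense in K, all of K is exposed, so the
  plaques of K are isolated, and a leaf which is dense in K is all of K
  ([leaf_closed]).  Hence a leaf that is not dense is compact; and if some leaf
  is dense then all are, since leaf closures form a partition. *)

(** * Connectedness *)

(** The form in which connectedness of plaques is used: a property that is
locally constant along A is constant on A. *)
Lemma connected_locally_constant (T : topologicalType) (A P : set T) :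
  connected A ->
  (forall y, A y -> \forall y' \near y, A y' -> (P y' <-> P y)) ->
  forall x y, A x -> A y -> P x -> P y.
Proof.
move=> cA lcP x y Ax Ay Px.
suff AP : A `&` P = A by have [] : (A `&` P) y by rewrite AP.
apply: cA; first by exists x.
- exists (interior [set z | A z -> P z]); first exact: open_interior.
  apply/seteqP; split => z [Az Pz]; split => //.
    by apply: filterS (lcP z Az) => z' H Az'; apply/H.
  exact: (nbhs_singleton Pz).
- exists (closure (A `&` P)); first exact: closed_closure.
  apply/seteqP; split => z [Az Pz]; split => //; first exact: subset_closure.
  by have [z' [[Az' Pz'] H]] := Pz _ (lcP z Az); apply/H.
Qed.

Lemma convex_connected (R : realType) (V : normedModType R) (C : set V) :
  (forall x y (t : R), C x -> C y -> 0 <= t <= 1 -> C (x + t *: (y - x))) ->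
  connected C.
Proof.
move=> convC; have [->|/set0P[b Cb]] := eqVneq C set0; first exact: connected0.
pose seg y : set V := (fun t : R => b + t *: (y - b)) @` `[0, 1].
suff -> : C = \bigcup_(y in C) seg y.
  apply: bigcup_connected.
    by exists b => y _; exists 0; rewrite /= ?in_itv/= ?lexx ?ler01// scale0r addr0.
  move=> y _; apply: connected_continuous_connected; first exact: segment_connected.
  apply: continuous_subspaceT => t.
  by apply: cvgD; [exact: cvg_cst | apply: cvgZr_tmp; exact: cvg_id].
apply/seteqP; split=> y.
  move=> Cy; exists y => //; exists 1; rewrite /= ?in_itv/= ?lexx ?ler01//.
  by rewrite scale1r addrC subrK.
by move=> [z Cz [t /= + <-]]; rewrite in_itv/= => t01; exact: convC.
Qed.

Lemma is_interval_convex (R : realType) (J : set R) (a b t : R) :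
  is_interval J -> J a -> J b -> 0 <= t <= 1 -> J (a + t * (b - a)).
Proof.
move=> iJ Ja Jb t01; have [ab|ba] := leP a b.
  by apply: (iJ a b) => //; nra.
by apply: (iJ b a) => //; nra.
Qed.

(** * Leaves and saturated sets *)

Section Leaves.
Context {R : realType} {n : nat} {M : topologicalType} (F : foliation R n M).

Lemma leafxx x : leaf F x x.
Proof. exact: rst_refl. Qed.

Lemma leaf_sym x y : leaf F x y -> leaf F y x.
Proof. exact: rst_sym. Qed.

Lemma leaf_trans y x z : leaf F x y -> leaf F y z -> leaf F x z.
Proof. exact: rst_trans. Qed.

Definition saturated (X : set M) := forall y z, leaf F y z -> X y -> X z.

(** Plaques are connected, so saturation can be tested locally, on the points at
the same height near a given point. *)
Lemma locally_saturated (P : set M) :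
  (forall c y, fol_atlas F c -> chart_dom c y ->
    \forall y' \near y, height c y' = height c y -> leaf F y y' -> (P y' <-> P y)) ->
  saturated P.
Proof.
move=> lcP; suff H y z : leaf F y z -> (P y <-> P z) by move=> y z /H[].
elim=> {y z} [y z|//|y z _|x y z _ H1 _ H2]; [|by case|by rewrite H1].
move=> [c Fc cyz].
have cyy : plaque c y y.
  by case: cyz => A [Ay sA cA] Az; exists A.
suff H u v : plaque c y u -> plaque c y v -> P u -> P v by split; exact: H.
apply: connected_locally_constant; first exact: component_connected.
move=> w yw; have [cw hw] := connected_component_sub yw.
apply: filterS (lcP c w Fc cw) => w' H yw'; apply: H.
  by have [_ ->] := connected_component_sub yw'.
by apply: (@leaf_trans y); [apply: leaf_sym|]; apply: rst_step; exists c.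
Qed.

(** * Flow boxes *)

(** A region where the foliation looks like a product, described by its height
alone.  [box_local] keeps what the product structure is used for: arbitrarily
small sub-boxes O around p which realize all heights of B close to that of p, and
in which one can move to another height without leaving O or the interval of
heights in between.  The form of [box_compat], and the absence of any preferred
direction, make the notion stable under changing the sign of h. *)
Record flow_box (B : set M) (h : M -> R) : Prop := FlowBox {
  box_open : open B;
  box_cont : forall x, B x -> h @ x --> h x;
  box_leaf : forall x y, B x -> B y -> h x = h y -> leaf F x y;
  box_conn : connected B;
  box_local : forall p N, B p -> nbhs p N -> exists O (e : R),
    [/\ 0 < e, nbhs p O, O `<=` B `&` N,
      (forall z, B z -> `|h z - h p| < e -> exists2 z', O z' & h z' = h z) &
      forall J, is_interval J -> connected (O `&` h @^-1` J)];
  box_compat : forall d y, fol_atlas F d -> B y -> chart_dom d y ->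
    \forall y' \near y, (height d y' = height d y) <-> (h y' = h y) }.

(** Turning a box upside down halves the work: only statements about what lies
above a point need a proof. *)
Lemma flow_boxN B h : flow_box B h -> flow_box B (- h).
Proof.
case=> oB ch lh cB Bl Bc; split=> //.
- by move=> x Bx; apply: cvgN; exact: ch.
- by move=> x y Bx By /oppr_inj; exact: lh.
- move=> p N Bp pN; have [O [e [e0 pO OBN Oh Oc]]] := Bl p N Bp pN.
  exists O, e; split=> // [z Bz|J iJ].
    rewrite !fctE -opprD normrN => /(Oh z Bz)[z' Oz' <-]; by exists z'.
  apply: (Oc (-%R @^-1` J)) => x y /= Jx Jy z xyz.
  by apply: iJ Jy Jx _ _; rewrite !lerN2 andbC.
- move=> d y Fd By dy; apply: filterS (Bc d y Fd By dy) => y' ->.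
  by rewrite !fctE; split=> [->|/oppr_inj].
Qed.

Definition cube (c : chart R n M) (p : M) (e : R) : set M :=
  chart_dom c `&` [set y | ball (chart_map c p) e (chart_map c y)].

Lemma chart_map_continuous (c : chart R n M) x :
  chart_dom c x -> chart_map c @ x --> chart_map c x.
Proof.
move=> cx; have := chart_map_cont (c := c).
rewrite continuous_open_subspace; last exact: chart_dom_open.
by apply; rewrite inE.
Qed.

Lemma cube_open c p e : open (cube c p e).
Proof.
rewrite openE => y [cy ye]; apply: filterI.
  by apply: open_nbhs_nbhs; split=> //; exact: chart_dom_open.
have yN : nbhs (chart_map c y) (ball (chart_map c p) e).
  by apply: open_nbhs_nbhs; split=> //; exact: ball_open.
exact: (chart_map_continuous cy yN).
Qed.

Lemma height_continuous (c : chart R n M) x :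
  chart_dom c x -> height c @ x --> height c x.
Proof.
move=> cx; apply: (@cvg_comp _ _ _ (chart_map c) (fun v : 'rV[R]_n.+1 => v 0 ord_max)).
  exact: chart_map_continuous cx.
exact: coord_continuous.
Qed.

(** The cube of radius e around p, cut by the half-space, is entirely covered by
the chart; then it is convex in coordinates. *)
Definition fits (c : chart R n M) (p : M) (e : R) :=
  0 < e /\ half_space (chart_axis c) `&` ball (chart_map c p) e `<=` chart_cod c.

Lemma cube_center c p e : chart_dom c p -> fits c p e -> cube c p e p.
Proof. by move=> cp [e0 _]; split=> //; exact: ballxx. Qed.

Lemma cod_half_space (c : chart R n M) v :
  chart_cod c v -> half_space (chart_axis c) v.
Proof. by have [O _ ->] := chart_cod_open c => -[]. Qed.

Lemma small_cube c p N : chart_dom c p -> nbhs p N ->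
  exists2 e, fits c p e & cube c p e `<=` N.
Proof.
move=> cp pN; have [O Oo codE] := chart_cod_open c.
have cmp := chart_mapP cp.
have Omp : O (chart_map c p) by move: cmp; rewrite codE => -[].
have : {for chart_map c p, continuous (chart_inv c : subspace (chart_cod c) -> M)}.
  exact: chart_inv_cont.
rewrite /prop_for /continuous_at /= chart_mapK// => /(_ _ pN).
rewrite -[nbhs (_ @ _) _]/(nbhs _ _).
case: (nbhs_subspaceP (chart_cod c)) => // _; rewrite /= withinE => -[W mW WE].
have /nbhs_ballP[e /= e0 eOW] : nbhs (chart_map c p) (O `&` W).
  by apply: filterI => //; apply: open_nbhs_nbhs.
exists e; first split=> //.
  by rewrite codE => v [hv /eOW[]].
move=> y [cy /eOW[Oy Wy]]; have cody := chart_mapP cy.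
have : (chart_inv c @^-1` N `&` chart_cod c) (chart_map c y).
  by rewrite WE.
by case=> /=; rewrite chart_mapK.
Qed.

Lemma cube_connected c p e J : chart_dom c p -> fits c p e ->
  is_interval J -> connected (cube c p e `&` height c @^-1` J).
Proof.
move=> cp [e0 fe] iJ.
pose C := [set v : 'rV[R]_n.+1 | [/\ half_space (chart_axis c) v,
  ball (chart_map c p) e v & J (v 0 ord_max)]].
have Ccod : C `<=` chart_cod c by move=> v [hv bv _]; apply: fe.
suff -> : cube c p e `&` height c @^-1` J = chart_inv c @` C.
  apply: connected_continuous_connected.
    apply: convex_connected => x y t [hx bx Jx] [hy [_ by_] Jy] t01.
    split; rewrite /half_space /= ?mxE.
    - have := @is_interval_convex _ [set r | 0 <= r] (x 0 (chart_axis c))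
        (y 0 (chart_axis c)) t.
      by apply=> // a b /= a0 _ r /andP[/(le_trans a0)].
    - split=> // i j; rewrite !mxE; case: bx => _ /(_ i j) bx.
      have := by_ i j; move: bx; rewrite /ball/= => bx byy.
      have := @is_interval_convex _ [set r | `|chart_map c p i j - r| < e]
        (x i j) (y i j) t.
      apply=> // a b /= ap bp r /andP[ar rb].
      by move: ap bp; rewrite !ltr_norml => /andP[? ?] /andP[? ?]; lra.
    - exact: is_interval_convex.
  by apply: continuous_subspaceW (chart_inv_cont (c := c)).
apply/seteqP; split=> y.
  move=> [[cy bye] Jy]; exists (chart_map c y); last exact: chart_mapK.
  by split=> //; apply: cod_half_space; exact: chart_mapP.
move=> [v Cv <-]; have cv := Ccod _ Cv; case: Cv => hv bv Jv.
split; first split; first exact: chart_invP.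
  by rewrite /= chart_invK.
by rewrite /= /height chart_invK.
Qed.

(** Replacing the last coordinate of p by the height of z stays in the
half-space: if the last coordinate defines it, because z has a nonnegative
height, and otherwise because p satisfies the inequality. *)
Lemma cube_height c p e z : chart_dom c p -> fits c p e -> chart_dom c z ->
  `|height c z - height c p| < e -> exists2 z', cube c p e z' & height c z' = height c z.
Proof.
move=> cp [e0 fe] cz hzp.
pose v : 'rV[R]_n.+1 :=
  \row_j if j == ord_max then height c z else chart_map c p 0 j.
have codv : (half_space (chart_axis c) `&` ball (chart_map c p) e) v.
  split.
    rewrite /half_space /= mxE; case: eqP => [axE|_].
      rewrite /height -axE; exact: cod_half_space (chart_mapP cz).
    exact: cod_half_space (chart_mapP cp).
  split=> // i j; rewrite mxE (ord1 i); case: eqP => [->|_]; last exact: ballxx.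
  by rewrite /ball/= distrC.
have cv := fe _ codv; exists (chart_inv c v).
  by split; [exact: chart_invP | rewrite /= chart_invK//; case: codv].
by rewrite /height chart_invK// mxE eqxx.
Qed.

Lemma flow_box_cube c p e : fol_atlas F c -> chart_dom c p -> fits c p e ->
  flow_box (cube c p e) (height c).
Proof.
move=> Fc cp fe; split.
- exact: cube_open.
- by move=> x [cx _]; exact: height_continuous.
- move=> x y Bx By hxy; apply: rst_step; exists c => //.
  exists (cube c p e `&` height c @^-1` [set height c x]); last by split.
  split=> //; first by move=> z [[cz _] hz]; split.
  apply: cube_connected => //.
  by move=> a b /= -> -> z /le_anti.
- have -> : cube c p e = cube c p e `&` height c @^-1` setT by rewrite preimage_setT setIT.
  exact: cube_connected.
- move=> q N Bq qN.
  have [r fr rN] : exists2 r, fits c q r & cube c q r `<=` cube c p e `&` N.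
    apply: small_cube; first by case: Bq.
    by apply: filterI => //; apply: open_nbhs_nbhs; split=> //; exact: cube_open.
  have cq : chart_dom c q by case: Bq.
  exists (cube c q r), r; split=> //.
  + by case: fr.
  + apply: open_nbhs_nbhs; split; [exact: cube_open|exact: cube_center].
  + by move=> z [cz _]; exact: cube_height.
  + by move=> J; exact: cube_connected.
- move=> d y Fd [cy _] dy.
  have [g Hg] := fol_compat Fc Fd cy dy; have [k Hk] := fol_compat Fd Fc dy cy.
  have gy := nbhs_singleton Hg; have ky := nbhs_singleton Hk.
  apply: filterS2 Hg Hk => y' Hg Hk.
  by split=> E; [rewrite Hk E -ky|rewrite Hg E -gy].
Qed.

Lemma flow_box_exists x : exists Bh : set M * (M -> R),
  flow_box Bh.1 Bh.2 /\ Bh.1 x.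
Proof.
have [c Fc cx] := fol_cover F x.
have [e fe _] := small_cube cx filterT.
by exists (cube c x e, height c); split; [exact: flow_box_cube|exact: cube_center].
Qed.

Lemma box_image_interval B h O : flow_box B h -> connected O -> O `<=` B ->
  is_interval (h @` O).
Proof.
move=> hB cO OB; apply/connected_intervalP.
apply: connected_continuous_connected => //.
apply: continuous_in_subspaceT => y; rewrite inE => Oy.
exact: (box_cont hB (OB _ Oy)).
Qed.

Lemma box_saturated B h X y z : flow_box B h -> saturated X -> B y -> B z ->
  h y = h z -> X y -> X z.
Proof. by move=> hB sX By Bz hyz; apply: sX; exact: (box_leaf hB). Qed.

Lemma box_nbhs B h y : flow_box B h -> B y -> nbhs y B.
Proof. by move=> hB By; apply: open_nbhs_nbhs; split=> //; exact: box_open hB. Qed.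

Lemma box_near B h y (J : set R) : flow_box B h -> B y -> open J -> J (h y) ->
  \forall y' \near y, J (h y').
Proof.
move=> hB By oJ Jy; apply: (box_cont hB By).
exact: open_nbhs_nbhs.
Qed.

(** By saturation, a closed set that misses a neighborhood of y misses in the
whole box all the heights close to that of y. *)
Lemma box_height_gap B h X y : flow_box B h -> saturated X -> closed X ->
  B y -> ~ X y -> exists2 r : R, 0 < r & forall z, B z -> `|h z - h y| < r -> ~ X z.
Proof.
move=> hB sX cX By nXy.
have yN : nbhs y (~` X) by apply: open_nbhs_nbhs; split=> //; rewrite openC.
have [O [r [r0 _ OX hO _]]] := box_local hB By yN.
exists r => // z Bz /(hO _ Bz)[z' Oz' hz'] Xz.
have [Bz' nXz'] := OX _ Oz'.
by apply: nXz'; apply: (box_saturated hB sX Bz Bz') => //.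
Qed.

(** * Heights separated by a saturated set *)

(** No height of S separates y from z in the box; equivalently, y and z are in
the same strip. *)
Definition linked S (B : set M) (h : M -> R) y z := exists J, [/\ is_interval J,
  J (h y), J (h z) & forall s, B s -> S s -> ~ J (h s)].

Lemma linked_sym S B h y z : linked S B h y z -> linked S B h z y.
Proof. by move=> [J [iJ Jy Jz JS]]; exists J. Qed.

Lemma linked_trans S B h y x z :
  linked S B h x y -> linked S B h y z -> linked S B h x z.
Proof.
move=> [J [iJ Jx Jy JS]] [J' [iJ' J'y J'z J'S]]; exists (J `|` J'); split.
- apply/connected_intervalP; apply: connectedU; first by exists (h y).
  + exact/connected_intervalP.
  + exact/connected_intervalP.
- by left.
- by right.
- by move=> s Bs Ss [/JS|/J'S]; apply.
Qed.

(** Moving up from y by d or more in height meets S, already at distance less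
than d from y. *)
Definition fine_above S (B : set M) (h : M -> R) d y := forall z J, B z ->
  is_interval J -> J (h y) -> J (h z) -> d <= h z - h y ->
  exists s, [/\ S s, B s, J (h s) & `|h s - h y| < d].

Definition fine S (B : set M) (h : M -> R) d y := forall z J, B z ->
  is_interval J -> J (h y) -> J (h z) -> d <= `|h z - h y| ->
  exists s, [/\ S s, B s, J (h s) & `|h s - h y| < d].

Lemma is_intervalN (J : set R) : is_interval J -> is_interval (-%R @^-1` J).
Proof.
move=> iJ x y /= Jx Jy z xyz.
by apply: iJ Jy Jx _ _; rewrite !lerN2 andbC.
Qed.

Lemma fineP S B h d y :
  fine_above S B h d y -> fine_above S B (- h) d y -> fine S B h d y.
Proof.
move=> fu fd z J Bz iJ Jy Jz; have [hyz|hzy] := leP (h y) (h z).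
  by rewrite ger0_norm ?subr_ge0//; exact: fu.
rewrite ltr0_norm ?subr_lt0// => dz.
have [s [Ss Bs Js hs]] : exists s, [/\ S s, B s, (-%R @^-1` J) ((- h) s) &
    `|(- h) s - (- h) y| < d].
  apply: (fd z); rewrite ?fctE /= ?opprK//; first exact: is_intervalN.
  by lra.
exists s; split=> //; first by move: Js; rewrite /= fctE opprK.
by move: hs; rewrite !fctE -opprD normrN.
Qed.

(** * Exposed points *)

(** The interval J leads from y to S, and y carries the only height of K in it. *)
Definition exposed (S K B : set M) (h : M -> R) y := K y /\ exists s J,
  [/\ S s, B s, is_interval J, J (h y) /\ J (h s) &
  forall k, K k -> B k -> J (h k) -> h k = h y].

Lemma exposedN S K B h y : exposed S K B h y -> exposed S K B (- h) y.
Proof.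
move=> [Ky [s [J [Ss Bs iJ [Jy Js] JK]]]]; split=> //.
exists s, (-%R @^-1` J); split=> //; first exact: is_intervalN.
  by rewrite /= !fctE !opprK.
by move=> k Kk Bk; rewrite /= !fctE opprK => /(JK k Kk Bk) ->.
Qed.

(** Two exposed heights above y and in the gap of S around y would be equal: the
interval leading from the lower one to S would have to cross either the higher
one or y.  So at most one exposed height lies there, and no exposed height is
above y and close enough to it. *)
Lemma exposed_below S K B h y : flow_box B h -> saturated S -> closed S ->
  B y -> K y -> ~ S y -> \forall y' \near y, B y' -> exposed S K B h y' -> h y' <= h y.
Proof.
move=> hB sS cS By Ky nSy; have [r r0 rS] := box_height_gap hB sS cS By nSy.
have key y1 y2 : B y1 -> B y2 -> exposed S K B h y1 -> K y2 ->
    h y < h y1 -> h y1 < h y2 -> h y2 < h y + r -> False.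
  move=> By1 By2 [Ky1 [s [J [Ss Bs iJ [Jy1 Js] JK]]]] Ky2 yy1 y12 y2r.
  have := rS s Bs; case: ltP => [_ /(_ isT)//|+ _].
  rewrite ler_normr => /orP[rs|rs].
    have E : h y2 = h y1 by apply: JK => //; apply: (iJ _ _ Jy1 Js); lra.
    by move: y12; rewrite E ltxx.
  have E : h y = h y1 by apply: JK => //; apply: (iJ _ _ Js Jy1); lra.
  by move: yy1; rewrite E ltxx.
have [[y1 [By1 ey1 yy1 y1r]]|noy1] :=
    pselect (exists y1, [/\ B y1, exposed S K B h y1, h y < h y1 & h y1 < h y + r]).
  have Jy1 : [set` `]-oo, h y1[] (h y) by rewrite /= in_itv.
  apply: filterS (box_near hB By (interval_open _ _) Jy1) => // y' /=.
  rewrite in_itv /= => y'1 By' ey'; rewrite leNgt; apply/negP => yy'.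
  by apply: (key y' y1) => //; case: ey1.
have Jyr : [set` `]-oo, (h y + r)[] (h y) by rewrite /= in_itv/= ltrDl.
apply: filterS (box_near hB By (interval_open _ _) Jyr) => // y' /=.
rewrite in_itv /= => y'1 By' ey'; rewrite leNgt; apply/negP => yy'.
by apply: noy1; exists y'.
Qed.

Lemma exposed_isolated S K B h y : flow_box B h -> saturated S -> closed S ->
  B y -> K y -> ~ S y -> \forall y' \near y, exposed S K B h y' -> h y' = h y.
Proof.
move=> hB sS cS By Ky nSy.
apply: filterS3 (box_nbhs hB By) (exposed_below hB sS cS By Ky nSy)
  (exposed_below (flow_boxN hB) sS cS By Ky nSy) => y' By' Hu Hd ey'.
apply/le_anti/andP; split; first exact: Hu.
by rewrite -lerN2; apply: Hd => //; exact: exposedN.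
Qed.

(** Both heights are locally functions of each other on an overlap, since both
are functions of the height of any chart of the atlas. *)
Lemma box_level_constant B1 h1 B2 h2 A u v : flow_box B1 h1 -> flow_box B2 h2 ->
  connected A -> A `<=` B1 `&` B2 -> (forall u v, A u -> A v -> h1 u = h1 v) ->
  A u -> A v -> h2 u = h2 v.
Proof.
move=> hB1 hB2 cA AB h1A Au Av; apply/esym.
apply: (connected_locally_constant (P := [set w | h2 w = h2 u]) cA _ Au Av) => //.
move=> w Aw; have [B1w B2w] := AB _ Aw.
have [c Fc cw] := fol_cover F w.
apply: filterS2 (box_compat hB1 Fc B1w cw) (box_compat hB2 Fc B2w cw).
by move=> w' H1 H2 Aw'; rewrite /= (H2.1 _)//; apply/H1; exact: h1A.
Qed.

(** A point w near y and off K lies in a gap of the heights of K; the end of that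
gap towards y is the height of a point which is exposed as soon as S contains
w. *)
Lemma exposed_near B h K y : flow_box B h -> saturated K -> closed K ->
  B y -> K y -> ~ nbhs y K -> forall C, nbhs y C ->
  exists2 w, ~ K w & forall S, S w -> exists2 k, C k & exposed S K B h k.
Proof.
move=> + sK cK By Ky nKy C yC; wlog : h / True => [H hB|_ hB]; first exact: H.
have [O [e [e0 yO OBC _ cO]]] := box_local hB By yC.
have [w Ow nKw] : exists2 w, O w & ~ K w.
  apply: contrapT => nex; apply: nKy; apply: filterS yO => z Oz.
  by apply: contrapT => nKz; apply: nex; exists z.
have [Bw _] := OBC _ Ow.
have hyw : h y <> h w by move=> E; apply: nKw; exact: (box_saturated hB sK By Bw E).
exists w => // S Sw.
have {}cO : connected O.
  by have := cO setT; rewrite preimage_setT setIT; apply => ? ? ? ? ?.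
have iO := box_image_interval hB cO (fun z Oz => (OBC z Oz).1).
have Oy := nbhs_singleton yO.
wlog hlt : h hB hyw iO / h y < h w => [H|].
  have [|hle] := ltP (h y) (h w); first exact: H.
  have hlt : h w < h y by rewrite lt_neqAle hle andbT; apply/eqP/nesym.
  have [||||k Ck ek] := H (- h).
  - exact: flow_boxN.
  - by rewrite !fctE => /oppr_inj.
  - exact: (box_image_interval (flow_boxN hB) cO (fun z Oz => (OBC z Oz).1)).
  - by rewrite !fctE ltrN2.
  by exists k => //; have := exposedN ek; rewrite opprK.
(* The end of the gap is the largest height of K between those of y and w. *)
pose E := [set t | h y <= t <= h w /\ exists k, [/\ K k, B k & h k = t]].
have Ey : E (h y) by split; [rewrite lexx ltW | exists y].
have ubE : has_ubound E by exists (h w) => t [/andP[]].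
have supE : has_sup E by split => //; exists (h y).
pose t0 := sup E.
have yt0 : h y <= t0 by exact: (ub_le_sup ubE Ey).
have t0w : t0 <= h w by apply: ge_sup; [exists (h y)|move=> t [/andP[]]].
have [u Ou hu] : (h @` O) t0.
  by apply: (iO (h y) (h w)); [exists y|exists w|rewrite yt0 t0w].
have [Bu Cu] := OBC _ Ou.
have Ku : K u.
  apply: contrapT => nKu; have [r r0 rK] := box_height_gap hB sK cK Bu nKu.
  have [t [tb [k [Kk Bk kt]]] tr] := sup_adherent r0 supE.
  have tt0 : t <= t0.
    apply: (ub_le_sup ubE); split; last by exists k.
    exact: tb.
  by apply: (rK k Bk _ Kk); rewrite kt hu -/t0 ler0_norm; move: tr; rewrite -/t0; lra.
exists u => //; split=> //; exists w, [set` `[t0, h w]]; split=> //.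
- by apply: interval_is_interval.
- by rewrite /= !in_itv /= hu !lexx t0w.
- move=> k Kk Bk; rewrite /= in_itv/= hu => /andP[t0k kw]; apply/le_anti.
  rewrite t0k andbT; apply: (ub_le_sup ubE); split; last by exists k.
  by rewrite kw (le_trans yt0).
Qed.

(** * Finite covers and separators *)

(** The covering form of compactness, for spaces without a base point; the filter
is the one of finite sequences ordered by inclusion. *)
Lemma compact_finite_cover (T : topologicalType) (f : T -> set T) :
  compact [set: T] -> (forall x, nbhs x (f x)) ->
  exists s : seq T, forall y, exists2 x, x \in s & f x y.
Proof.
move=> /compact_near_coveringP cT fN.
pose G : set_system (seq T) :=
  [set P | exists s0 : seq T, forall s : seq T, {subset s0 <= s} -> P s].
have GF : Filter G.
  split.
  - by exists [::].
  - move=> P Q [s Ps] [s' Qs']; exists (s ++ s') => t st; split.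
      by apply: Ps => z zs; apply: st; rewrite mem_cat zs.
    by apply: Qs' => z zs; apply: st; rewrite mem_cat zs orbT.
  - by move=> P Q PQ [s Ps]; exists s => t /Ps /PQ.
have [] := cT _ G (fun s y => exists2 x, x \in s & f x y) GF.
  move=> x _; exists (f x, [set s : seq T | x \in s]) => /=.
    by split; [exact: fN | exists [:: x] => s; apply; rewrite inE].
  by move=> [y s] /= [fxy xs]; exists x.
by move=> s /(_ s (fun _ => id)) Hs; exists s => y; exact: Hs.
Qed.

(** The closed sets C i make compactness available inside the open boxes B i. *)
Lemma flow_box_cover : hausdorff_space M -> compact [set: M] ->
  exists (I : finType) (B : I -> set M) (h : I -> M -> R) (C : I -> set M),
    [/\ forall i, flow_box (B i) (h i), forall i, C i `<=` B i,
        forall i, closed (C i) & forall x : M, exists i, nbhs x (C i)].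
Proof.
move=> hM cM; have [f fP] := choice flow_box_exists.
have /choice[C CP] x : exists A, [/\ nbhs x A, A `<=` (f x).1 & closed A].
  have [fbx fx] := fP x.
  have [A xA AB] := compact_regular hM cM (@filterT _ (nbhs x) _) (box_nbhs fbx fx).
  exists (closure A); split=> //; last exact: closed_closure.
  exact: filterS (@subset_closure _ A) xA.
have intC x : nbhs x (interior (C x)).
  by have [xC _ _] := CP x; exact: nbhs_interior.
have [s sP] := compact_finite_cover cM intC.
exists (seq_sub s : finType), (fun i => (f (val i)).1), (fun i => (f (val i)).2).
exists (fun i => C (val i)); split.
- by move=> i; have [] := fP (val i).
- by move=> i; have [] := CP (val i).
- by move=> i; have [] := CP (val i).
- by move=> y; have [x xs xy] := sP y; exists (SeqSub xs).
Qed.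

(** In applications K is the closure of a leaf and S a finite union of other leaf
closures. *)
Definition admissible (K S : set M) :=
  [/\ saturated S, closed S & forall y, K y -> ~ S y].

Lemma admissibleU (K : set M) S T : admissible K S -> admissible K T -> admissible K (S `|` T).
Proof.
move=> [sS cS dS] [sT cT dT]; split.
- by move=> y z yz [/(sS _ _ yz)|/(sT _ _ yz)]; [left|right].
- exact: closedU.
- by move=> y Ky [/(dS _ Ky)|/(dT _ Ky)].
Qed.

Lemma admissible0 K : admissible K set0.
Proof. by split=> [? ? _ []| |? _ []]; exact: closed0. Qed.

(** Either some height of the box is slightly above that of y, and then K, having
empty interior, leaves room for an admissible T at such a height; or y is at the
top of the box, up to d / 2, and there is nothing to separate.  The first witness
still works for all points near y. *)
Lemma fine_above_near (K : set M) B h d y :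
  (forall w, ~ K w -> exists2 T, admissible K T & T w) ->
  (forall z : M, ~ nbhs z K) -> flow_box B h -> B y -> 0 < d ->
  exists2 T, admissible K T &
    \forall y' \near y, forall S, T `<=` S -> fine_above S B h d y'.
Proof.
move=> offK nK hB By d0.
have [[z [Bz yz zd]]|noz] := pselect (exists z, [/\ B z, h y < h z & h z < h y + d / 2]).
  have Jz : [set` `]h y, (h y + d / 2)[] (h z) by rewrite /= in_itv/= yz.
  have [w [Bw] wJ nKw] : exists w, [/\ B w, h w \in `]h y, (h y + d / 2)[ & ~ K w].
    apply: contrapT => now; apply: (nK z).
    apply: filterS2 (box_nbhs hB Bz) (box_near hB Bz (interval_open _ _) Jz) => // w Bw wJ.
    by apply: contrapT => nKw; apply: now; exists w.
  move: wJ; rewrite in_itv/= => /andP[yw wd].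
  have [T aT Tw] := offK w nKw; exists T => //.
  have Jy : [set` `](h y - d / 2), h w[] (h y) by rewrite /= in_itv/=; lra.
  apply: filterS (box_near hB By (interval_open _ _) Jy) => // y'.
  rewrite /= in_itv/= => /andP[y'l y'u] S TS z' J Bz' iJ Jy' Jz' dz'.
  exists w; split=> //; first exact: TS.
    by apply: (iJ _ _ Jy' Jz'); lra.
  by rewrite ger0_norm; lra.
exists set0; first exact: admissible0.
have Jy : [set` `](h y - d / 2), (h y + d / 2)[] (h y) by rewrite /= in_itv/=; lra.
apply: filterS2 (box_nbhs hB By) (box_near hB By (interval_open _ _) Jy) => // y' By'.
rewrite /= in_itv/= => /andP[y'l y'u] S _ z' J Bz' iJ Jy' Jz' dz'; exfalso.
have y'y : h y' <= h y.
  by rewrite leNgt; apply/negP => yy'; apply: noz; exists y'.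
have iB := box_image_interval hB (box_conn hB) (fun _ => id).
have [u Bu hu] : (h @` B) (h y + d / 4).
  by apply: (iB (h y) (h z')); [exists y|exists z'|lra].
by apply: noz; exists u; split=> //; rewrite hu; lra.
Qed.

Lemma fine_near (K : set M) B h d y :
  (forall w, ~ K w -> exists2 T, admissible K T & T w) ->
  (forall z : M, ~ nbhs z K) -> flow_box B h -> B y -> 0 < d ->
  exists2 T, admissible K T &
    \forall y' \near y, forall S, T `<=` S -> fine S B h d y'.
Proof.
move=> offK nK hB By d0.
have [T aT HT] := fine_above_near offK nK hB By d0.
have [T' aT' HT'] := fine_above_near offK nK (flow_boxN hB) By d0.
exists (T `|` T'); first exact: admissibleU.
apply: filterS2 HT HT' => y' H H' S TS; apply: fineP.
  by apply: H => t Tt; apply: TS; left.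
by apply: H' => t Tt; apply: TS; right.
Qed.

Section Cover.
Context (I : finType) (B : I -> set M) (h : I -> M -> R) (C : I -> set M).
Hypothesis cM : compact [set: M].
Hypothesis hB : forall i, flow_box (B i) (h i).
Hypothesis CB : forall i, C i `<=` B i.
Hypothesis Ccl : forall i, closed (C i).
Hypothesis Ccov : forall x : M, exists i, nbhs x (C i).

(** A Lebesgue number for the overlaps: sub-boxes O contained in two boxes and
realizing all heights within d. *)
Definition uniform d := forall i j y, C i y -> C j y ->
  exists O, [/\ O `<=` B i `&` B j, O y,
    forall z, B i z -> `|h i z - h i y| < d -> exists2 z', O z' & h i z' = h i z &
    forall J, is_interval J -> connected (O `&` h i @^-1` J)].

Lemma closed_near (A : set M) (P : R -> M -> Prop) : closed A ->
  (forall x, A x -> exists2 e, 0 < e & \forall x' \near x, forall d, 0 < d -> d < e -> P d x') ->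
  \forall d \near (0 : R)^'+, forall x, A x -> P d x.
Proof.
move=> cA HP; have : compact A by apply: (subclosed_compact cA cM).
move=> /compact_near_coveringP cov; apply: (cov _ _ P) => x Ax.
have [e e0 He] := HP x Ax.
exists ([set x' | forall d, 0 < d -> d < e -> P d x'], [set d | 0 < d < e]) => /=.
  split=> //; near=> d; apply/andP; split; first by near: d; exact: nbhs_right_gt.
  by near: d; exact: nbhs_right_lt.
by move=> [x' d] /= [H /andP[d0 de]]; exact: H.
Unshelve. all: by end_near. Qed.

Lemma uniform_near : \forall d \near (0 : R)^'+, uniform d.
Proof.
apply: filter_forall => i; apply: filter_forall => j.
suff : \forall d \near (0 : R)^'+, forall y, (C i `&` C j) y ->
  exists O, [/\ O `<=` B i `&` B j, O y,
    forall z, B i z -> `|h i z - h i y| < d -> exists2 z', O z' & h i z' = h i z &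
    forall J, is_interval J -> connected (O `&` h i @^-1` J)].
  by apply: filterS => d H y Ciy Cjy; exact: H.
apply: closed_near; first exact: closedI.
move=> p [/CB Bip /CB Bjp].
have [O [e [e0 pO OB hO cO]]] := box_local (hB i) Bip (box_nbhs (hB j) Bjp).
exists (e / 2); first by rewrite divr_gt0.
have Jp : [set` `](h i p - e / 2), (h i p + e / 2)[] (h i p) by rewrite /= in_itv/=; lra.
apply: filterS2 pO (box_near (hB i) Bip (interval_open _ _) Jp) => // y Oy.
rewrite /= in_itv/= => /andP[yl yu] d d0 de; exists O; split=> // z Bz hzy.
by apply: hO => //; move: hzy; rewrite !ltr_norml => /andP[? ?]; apply/andP; split; lra.
Qed.

(** Strips around K of height less than d are contained in U when d is small. *)
Lemma close_near (K U : set M) : saturated K -> closed K -> open U -> K `<=` U ->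
  \forall d \near (0 : R)^'+, forall i y k, C i y -> B i k -> K k ->
    `|h i y - h i k| < d -> U y.
Proof.
move=> sK cK oU KU; apply: filter_forall => i.
suff : \forall d \near (0 : R)^'+, forall y, (C i `&` ~` U) y -> forall k, B i k ->
    K k -> d <= `|h i y - h i k|.
  apply: filterS => d H y k Ciy Bk Kk; apply: contraTP => nUy.
  by rewrite -leNgt; exact: H.
apply: closed_near; first by apply: closedI => //; exact: open_closedC.
move=> y [/CB Bi nUy].
have nKy : ~ K y by move/KU.
have [r r0 rK] := box_height_gap (hB i) sK cK Bi nKy.
exists (r / 2); first by rewrite divr_gt0.
have Jy : [set` `](h i y - r / 2), (h i y + r / 2)[] (h i y) by rewrite /= in_itv/=; lra.
apply: filterS (box_near (hB i) Bi (interval_open _ _) Jy) => // y'.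
rewrite /= in_itv/= => /andP[yl yu] d d0 de k Bk Kk.
rewrite leNgt; apply/negP => Hk; apply: (rK k Bk _ Kk).
by move: Hk; rewrite !ltr_norml => /andP[? ?]; apply/andP; split; lra.
Qed.

Definition all_fine (S : set M) d := forall i y, C i y -> fine S (B i) (h i) d y.

(** Locally an admissible set with the required property exists, and both
admissibility and the property survive finite unions; compactness is used
through the filter of admissible sets directed by inclusion. *)
Lemma fine_separator (K : set M) T0 d : (forall w, ~ K w -> exists2 T, admissible K T & T w) ->
  (forall z : M, ~ nbhs z K) -> admissible K T0 -> 0 < d ->
  exists S, [/\ admissible K S, T0 `<=` S & all_fine S d].
Proof.
move=> offK nK aT0 d0.
pose G : set_system (set M) := [set P | exists2 T, admissible K T &
  forall S, admissible K S -> T `<=` S -> P S].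
have GF : Filter G.
  split.
  - by exists set0 => //; exact: admissible0.
  - move=> P Q [S aS PS] [S' aS' QS']; exists (S `|` S'); first exact: admissibleU.
    move=> T aT ST; split; [apply: PS => // |apply: QS' => //] => z Sz; apply: ST.
      by left.
    by right.
  - by move=> P Q PQ [S aS PS]; exists S => // T aT ST; apply: PQ; exact: PS.
have : \forall S \near G, all_fine S d.
  apply: filter_forall => i.
  have /compact_near_coveringP cov : compact (C i).
    exact: (@subclosed_compact _ _ [set: M]).
  apply: (cov _ G (fun S y => fine S (B i) (h i) d y)) => y Ciy.
  have [T aT HT] := fine_near offK nK (hB i) (CB Ciy) d0.
  exists ([set y' | forall S, T `<=` S -> fine S (B i) (h i) d y'], [set S | T `<=` S]).
    by split=> //=; exists T.
  by move=> [y' S] /= [H TS]; exact: H.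
move=> [T aT HT]; exists (T0 `|` T); split; first exact: admissibleU.
  by move=> z; left.
by apply: HT; [exact: admissibleU | move=> z; right].
Qed.

Lemma image_level O i j J : O `<=` B i `&` B j ->
  connected (O `&` h i @^-1` J) -> is_interval (h j @` (O `&` h i @^-1` J)).
Proof.
by move=> OB cO; apply: (box_image_interval (hB j) cO) => z [/OB[]].
Qed.

(** * The strips around a leaf closure *)

(** A link is shorter than d because S is fine, so it can be copied inside a
sub-box O of the overlap.  There the heights between y and the copy of z form a
connected set missing S, whose image under the other height is an interval
missing S. *)
Lemma linked_transfer (S : set M) d i j y z : saturated S -> all_fine S d -> uniform d ->
  C i y -> C j y -> B i z -> linked S (B i) (h i) y z ->
  `|h i z - h i y| < d /\
  exists z', [/\ B i z', B j z', h i z' = h i z & linked S (B j) (h j) y z'].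
Proof.
move=> sS fS ud Ciy Cjy Bz [J [iJ Jy Jz JS]].
have hzy : `|h i z - h i y| < d.
  rewrite ltNge; apply/negP => dz.
  by have [s [Ss Bs /(JS s Bs Ss)]] := fS i y Ciy z J Bz iJ Jy Jz dz.
split=> //; have [O [OB Oy hO cO]] := ud i j y Ciy Cjy.
have [z' Oz' hz'] := hO z Bz hzy; have [Biz' Bjz'] := OB _ Oz'.
exists z'; split=> //; exists (h j @` (O `&` h i @^-1` J)); split.
- by apply: image_level => //; exact: cO.
- by exists y.
- by exists z' => //; split=> //=; rewrite hz'.
- move=> s Bs Ss [u [/OB[Biu Bju] Ju] hu]; apply: (JS u Biu _ Ju).
  exact: (box_saturated (hB j) sS Bs Bju (esym hu) Ss).
Qed.

(** The union of the strips that meet K. *)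
Definition tube (S K : set M) : set M := [set y | exists i k,
  [/\ C i y, K k, B i k & linked S (B i) (h i) y k]].

Lemma tube_transfer (S K : set M) d j y : saturated S -> saturated K -> all_fine S d ->
  uniform d -> tube S K y -> C j y ->
  exists k, [/\ K k, B j k & linked S (B j) (h j) y k].
Proof.
move=> sS sK fS ud [i [k [Ciy Kk Bk yk]]] Cjy.
have [_ [k' [Bik' Bjk' hk' yk']]] := linked_transfer sS fS ud Ciy Cjy Bk yk.
exists k'; split=> //.
exact: (box_saturated (hB i) sK Bk Bik' (esym hk') Kk).
Qed.

(** Off S, nearby points are linked to each other; so the tube is both open and
closed in the complement of S, and therefore saturated. *)
Lemma tube_locally_constant (S K : set M) d y : admissible K S -> saturated K ->
  all_fine S d -> uniform d -> ~ S y -> \forall y' \near y, tube S K y' <-> tube S K y.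
Proof.
move=> [sS cS _] sK fS ud nSy; have [j yC] := Ccov y.
have Cjy := nbhs_singleton yC.
have [r r0 rS] := box_height_gap (hB j) sS cS (CB Cjy) nSy.
have Jy : [set` `](h j y - r), (h j y + r)[] (h j y) by rewrite /= in_itv/=; lra.
apply: filterS2 yC (box_near (hB j) (CB Cjy) (interval_open _ _) Jy) => // y' Cjy' Jy'.
have yy' : linked S (B j) (h j) y y'.
  exists [set` `](h j y - r), (h j y + r)[]; split=> //.
    exact: interval_is_interval.
  move=> s Bs Ss; rewrite /= in_itv/= => /andP[sl su]; apply: (rS s Bs _ Ss).
  by rewrite ltr_norml; apply/andP; split; lra.
split=> ty.
  have [k [Kk Bk y'k]] := tube_transfer sS sK fS ud ty Cjy'.
  by exists j, k; split=> //; exact: linked_trans yy' y'k.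
have [k [Kk Bk yk]] := tube_transfer sS sK fS ud ty Cjy.
by exists j, k; split=> //; exact: linked_trans (linked_sym yy') yk.
Qed.

Lemma linked_notin (S : set M) i y z : C i y -> linked S (B i) (h i) y z -> ~ S y.
Proof. by move=> /CB By [J [_ Jy _ JS]] Sy; exact: (JS y By Sy Jy). Qed.

Lemma tube_saturated (S K : set M) d : admissible K S -> saturated K ->
  all_fine S d -> uniform d -> saturated (tube S K).
Proof.
move=> aS sK fS ud; have [sS cS dS] := aS; apply: locally_saturated => c y Fc cy.
have [Sy|nSy] := pselect (S y).
  have nt z : S z -> ~ tube S K z.
    by move=> Sz [i [k [Ciz _ _ /(linked_notin Ciz)]]].
  near=> y' => _ /(sS _ _) /(_ Sy) Sy'.
  by split=> [/(nt _ Sy')|/(nt _ Sy)].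
by apply: filterS (tube_locally_constant aS sK fS ud nSy).
Unshelve. all: by end_near. Qed.

Lemma sub_tube (S K : set M) : admissible K S -> saturated K -> K `<=` tube S K.
Proof.
move=> [sS _ dS] sK k Kk; have [i /nbhs_singleton Cik] := Ccov k.
exists i, k; split=> //; first exact: CB.
exists [set h i k]; split=> //; first by move=> a b -> -> z /le_anti.
move=> s Bs Ss /= hsk; apply: (dS k Kk).
exact: (box_saturated (hB i) sS Bs (CB Cik) hsk Ss).
Qed.

(** * The exposed part of a leaf closure *)

(** As for links: by fineness the point of S can be chosen within d of y, and the
interval leading to it is then copied in the overlap.  Points of K in the copy
are at the height of y in one box, hence also in the other. *)
Lemma exposed_transfer (S K : set M) d i j y : saturated S -> saturated K ->
  all_fine S d -> uniform d -> C i y -> C j y ->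
  exposed S K (B i) (h i) y -> exposed S K (B j) (h j) y.
Proof.
move=> sS sK fS ud Ciy Cjy [Ky [s0 [J [Ss0 Bs0 iJ [Jy Js0] JK]]]]; split=> //.
have [s [Ss Bs Js hs]] : exists s, [/\ S s, B i s, J (h i s) & `|h i s - h i y| < d].
  have [?|dle] := ltP `|h i s0 - h i y| d; first by exists s0.
  exact: (fS i y Ciy s0).
have [O [OB Oy hO cO]] := ud i j y Ciy Cjy.
have [z Oz hz] := hO s Bs hs; have [Biz Bjz] := OB _ Oz.
exists z, (h j @` (O `&` h i @^-1` J)); split=> //.
- exact: (box_saturated (hB i) sS Bs Biz (esym hz) Ss).
- by apply: image_level => //; exact: cO.
- by split; [exists y | exists z => //; split=> //=; rewrite hz].
- move=> k Kk Bk [u [Ou Ju] huk]; have [Biu Bju] := OB _ Ou.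
  have Ku : K u by exact: (box_saturated (hB j) sK Bk Bju (esym huk) Kk).
  rewrite -huk.
  have iL : is_interval [set h i y] by move=> a b -> -> t /le_anti.
  apply: (box_level_constant (hB i) (hB j) (cO _ iL)).
  + by move=> t [/OB].
  + by move=> a b [_ /= ->] [_ /= ->].
  + by split=> //=; exact: JK.
  + by [].
Qed.

Definition exposed_part (S K : set M) : set M :=
  [set y | exists2 i, C i y & exposed S K (B i) (h i) y].

Lemma exposed_partE (S K : set M) d j y : saturated S -> saturated K ->
  all_fine S d -> uniform d -> C j y ->
  exposed_part S K y <-> exposed S K (B j) (h j) y.
Proof.
move=> sS sK fS ud Cjy; split=> [[i Ciy]|]; last by exists j.
exact: exposed_transfer fS ud Ciy Cjy.
Qed.

Lemma exposed_level (S K : set M) i y z : saturated K -> B i y -> B i z -> h i y = h i z ->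
  exposed S K (B i) (h i) y -> exposed S K (B i) (h i) z.
Proof.
move=> sK By Bz hyz [Ky [s [J [Ss Bs iJ Jys JK]]]]; split.
  exact: (box_saturated (hB i) sK By Bz hyz Ky).
by exists s, J; rewrite -hyz.
Qed.

Lemma exposed_part_saturated (S K : set M) d : saturated S -> saturated K ->
  all_fine S d -> uniform d -> saturated (exposed_part S K).
Proof.
move=> sS sK fS ud; apply: locally_saturated => c y Fc cy.
have [j yC] := Ccov y; have Cjy := nbhs_singleton yC.
apply: filterS2 yC (box_compat (hB j) Fc (CB Cjy) cy) => y' Cjy' H /H hjy _.
rewrite !(exposed_partE sS sK fS ud (j := j))//.
by split; apply: exposed_level => //; exact: CB.
Qed.

Lemma exposed_part_isolated (S K : set M) d y : admissible K S -> saturated K ->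
  all_fine S d -> uniform d -> K y -> exists j, [/\ C j y, nbhs y (C j) &
    \forall y' \near y, exposed_part S K y' -> h j y' = h j y].
Proof.
move=> [sS cS dS] sK fS ud Ky; have [j yC] := Ccov y.
have Cjy := nbhs_singleton yC; exists j; split=> //.
apply: filterS2 yC (exposed_isolated (hB j) sS cS (CB Cjy) Ky (dS _ Ky)).
by move=> y' Cjy' H /(exposed_partE sS sK fS ud Cjy').
Qed.

Lemma exposed_part_closed (S K : set M) d : admissible K S -> saturated K -> closed K ->
  all_fine S d -> uniform d -> closed (exposed_part S K).
Proof.
move=> aS sK cK fS ud; have [sS cS dS] := aS; move=> y ycl.
have Ky : K y.
  by apply: cK => N /ycl[z [[i _ [Kz _]] Nz]]; exists z.
have [j [Cjy yC iso]] := exposed_part_isolated aS sK fS ud Ky.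
have [y' [ey' [Cjy' /(_ ey') hy']]] := ycl _ (filterI yC iso).
apply/(exposed_partE sS sK fS ud Cjy).
apply: (exposed_level sK (CB Cjy') (CB Cjy) hy').
exact/(exposed_partE sS sK fS ud Cjy').
Qed.

End Cover.

(** * Almost periodic foliations *)

Lemma box_interior B h X u v : flow_box B h -> saturated X -> B u -> B v ->
  h u = h v -> nbhs u X -> nbhs v X.
Proof.
move=> hB sX Bu Bv huv uX; have [O [e [e0 _ OX hO _]]] := box_local hB Bu uX.
have Jv : [set` `](h u - e), (h u + e)[] (h v) by rewrite /= in_itv/= -huv; lra.
apply: filterS2 (box_nbhs hB Bv) (box_near hB Bv (interval_open _ _) Jv) => // z Bz.
rewrite /= in_itv/= => /andP[zl zu].
have [|z' Oz' hz'] := hO z Bz.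
  by rewrite ltr_norml; apply/andP; split; lra.
have [Bz' Xz'] := OX _ Oz'.
exact: (box_saturated hB sX Bz' Bz hz' Xz').
Qed.

Lemma interior_saturated X : saturated X -> saturated (interior X).
Proof.
move=> sX; apply: locally_saturated => c y Fc cy.
have [e fe _] := small_cube cy filterT.
have hB := flow_box_cube Fc cy fe; have By := cube_center cy fe.
apply: filterS (box_nbhs hB By) => y' By' hy _.
by split; apply: (box_interior hB).
Qed.

Section AlmostPeriodic.
Hypothesis hM : hausdorff_space M.
Hypothesis cM : compact [set: M].
Hypothesis connM : connected [set: M].
Hypothesis pap : pointwise_almost_periodic F.

Let capx x : closure (leaf F x) x.
Proof. by case: pap => + _ _; apply. Qed.

Let cap_sym x y : closure (leaf F x) y -> closure (leaf F y) x.
Proof. by case: pap => _ _; apply. Qed.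

Let cap_trans y x z :
  closure (leaf F x) y -> closure (leaf F y) z -> closure (leaf F x) z.
Proof. by case: pap => _ + _; apply. Qed.

Lemma leaf_closure_saturated x : saturated (closure (leaf F x)).
Proof. by move=> y z yz xy; apply: cap_trans xy _; exact: subset_closure. Qed.

Lemma leaf_closure_admissible x w : ~ closure (leaf F x) w ->
  exists2 T, admissible (closure (leaf F x)) T & T w.
Proof.
move=> xw; exists (closure (leaf F w)) => //; split.
- exact: leaf_closure_saturated.
- exact: closed_closure.
- by move=> y xy wy; apply: xw; apply: cap_trans xy (cap_sym wy).
Qed.

(** Otherwise the interior of K is saturated, so every leaf in K, being dense in
K, is contained in it: K would be open and closed. *)
Lemma leaf_closure_nowhere x : closure (leaf F x) <> setT ->
  forall z : M, ~ nbhs z (closure (leaf F x)).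
Proof.
set K := closure (leaf F x) => KT z zK; apply: KT.
have sKi := interior_saturated (@leaf_closure_saturated x).
suff KiT : interior K = setT.
  by apply/seteqP; split=> // y _; apply: interior_subset; rewrite KiT.
apply: connM; first by exists z.
  by exists (interior K); [exact: open_interior | rewrite setTI].
exists (closure (interior K)); first exact: closed_closure.
rewrite setTI; apply/seteqP; split; first exact: subset_closure.
move=> y yKi; have xy : K y.
  have := closureS (@interior_subset _ K) yKi.
  by rewrite -(closure_id K).1//; exact: closed_closure.
have yz : closure (leaf F y) z.
  exact: cap_trans (cap_sym xy) (nbhs_singleton zK).
have [u [yu uK]] := yz _ (nbhs_interior zK).
exact: (sKi _ _ (leaf_sym yu) uK).
Qed.

Lemma saturated_neighborhood x U : open U -> closure (leaf F x) `<=` U ->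
  exists V, [/\ saturated V, nbhs x V & V `<=` U].
Proof.
set K := closure (leaf F x) => oU KU.
have [KT|KT] := pselect (K = setT).
  by exists setT; split=> //; [exact: filterT | rewrite -KT].
have [I [B [h [C [hB CB Ccl Ccov]]]]] := flow_box_cover hM cM.
have sK : saturated K := @leaf_closure_saturated x.
have cK : closed K by exact: closed_closure.
have [d [d0 [ud cd]]] : exists d : R, 0 < d /\ uniform B h C d /\
    forall i y k, C i y -> B i k -> K k -> `|h i y - h i k| < d -> U y.
  near (0 : R)^'+ => d; exists d; split; last split.
  - by near: d; exact: nbhs_right_gt.
  - by near: d; apply: uniform_near.
  - by near: d; apply: close_near.
have [S [aS _ fS]] := fine_separator cM hB CB Ccl (@leaf_closure_admissible x)
  (leaf_closure_nowhere KT) (admissible0 _) d0.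
have [sS _ dS] := aS.
have Kx : K x := @capx x.
have tx := sub_tube hB CB Ccov aS sK Kx.
exists (tube B h C S K); split.
- exact: (tube_saturated hB CB Ccov aS sK fS ud).
- by apply: filterS (tube_locally_constant hB CB Ccov aS sK fS ud (dS x Kx)) => y ->.
- move=> y [i [k [Ciy Kk Bk yk]]]; apply: (cd i y k) => //.
  by have [] := linked_transfer hB sS fS ud Ciy Ciy Bk yk; rewrite distrC.
Unshelve. all: by end_near. Qed.

Lemma almost_periodic_R_closed : R_closed F.
Proof.
move=> [x y] /= xycl; apply: contrapT => nxy.
have yN : nbhs y (~` closure (leaf F x)).
  by apply: open_nbhs_nbhs; split=> //; apply: closed_openC; exact: closed_closure.
have [A yA AK] := compact_regular hM cM (@filterT _ (nbhs y) _) yN.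
have oU : open (~` closure A) by apply: closed_openC; exact: closed_closure.
have [V [sV xV VU]] : exists V, [/\ saturated V, nbhs x V & V `<=` ~` closure A].
  by apply: saturated_neighborhood oU _ => z xz /AK.
have [[x' y'] [/= x'y' [/= Vx' Ay']]] : [set z : M * M | closure_relation F z.1 z.2]
    `&` [set z | V z.1 /\ interior A z.2] !=set0.
  apply: xycl; exists (V, interior A) => //=; split=> //; exact: nbhs_interior.
have [u [x'u Au]] := x'y' _ Ay'.
by apply: (VU u (sV _ _ x'u Vx')); exact: subset_closure.
Qed.

(** A leaf meets a neighborhood of y in K only on the plaque of y, once all of K
is known to be exposed. *)
Lemma leaf_closed x : closure (leaf F x) <> setT -> closure (leaf F x) `<=` leaf F x.
Proof.
set K := closure (leaf F x) => KT.
have [I [B [h [C [hB CB Ccl Ccov]]]]] := flow_box_cover hM cM.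
have sK : saturated K := @leaf_closure_saturated x.
have cK : closed K by exact: closed_closure.
have nK := leaf_closure_nowhere KT.
have [j xC] := Ccov x.
have [w nKw Sw] := exposed_near (hB j) sK cK (CB _ _ (nbhs_singleton xC)) (@capx x) (nK x) xC.
have [T aT Tw] := leaf_closure_admissible nKw.
have [d [d0 ud]] : exists d : R, 0 < d /\ uniform B h C d.
  near (0 : R)^'+ => d; exists d; split.
  - by near: d; exact: nbhs_right_gt.
  - by near: d; apply: uniform_near.
have [S [aS TS fS]] := fine_separator cM hB CB Ccl (@leaf_closure_admissible x) nK aT d0.
have [sS cS dS] := aS.
have [k Ck ek] := Sw S (TS _ Tw).
have Kk : K k by case: ek.
have sE := exposed_part_saturated hB CB Ccov sS sK fS ud.
have cE := exposed_part_closed hB CB Ccov aS sK cK fS ud.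
have KE : K `<=` exposed_part B h C S K.
  move=> y xy; apply: cE.
  apply: (closureS _ (cap_trans (cap_sym Kk) xy)) => u ku.
  by apply: sE ku _; exists j.
move=> y xy.
have [i [Ciy yC iso]] := exposed_part_isolated hB CB Ccov aS sK fS ud xy.
have [y' [xy' [Ciy' hy']]] := xy _ (filterI yC iso).
have Ky' : K y' by exact: subset_closure.
apply: leaf_trans xy' _; apply: (box_leaf (hB i)); try exact: CB.
by apply: hy'; exact: KE.
Unshelve. all: by end_near. Qed.

Lemma almost_periodic_minimal_or_compact :
  minimal_foliation F \/ compact_foliation F.
Proof.
have [[x xT]|nT] := pselect (exists x, closure (leaf F x) = setT); [left|right].
  move=> y O [z Oz] oO.
  have xz : closure (leaf F x) z by rewrite xT.
  have xy : closure (leaf F x) y by rewrite xT.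
  have [u [yu Ou]] := cap_trans (cap_sym xy) xz (open_nbhs_nbhs (conj oO Oz)).
  by exists u.
move=> x; have xcl : closure (leaf F x) = leaf F x.
  apply/seteqP; split; last exact: subset_closure.
  by apply: leaf_closed => xT; apply: nT; exists x.
apply: (@subclosed_compact _ _ [set: M]) => //.
by rewrite -xcl; exact: closed_closure.
Qed.

End AlmostPeriodic.

(** * The equivalence *)

(** Points z of the leaf of x near y satisfy x \in closure (leaf z), and z tends
to y: this gives symmetry.  For transitivity, let y be in closure (leaf x):
by symmetry x is in closure (leaf y) = closure (leaf v) for all v in leaf y, and
by symmetry again leaf y, hence its closure, is in closure (leaf x). *)
Lemma R_closed_almost_periodic : R_closed F -> pointwise_almost_periodic F.
Proof.
move=> Rcl.
have symR x y : closure (leaf F x) y -> closure (leaf F y) x.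
  move=> xy; apply: (Rcl (y, x)) => N [[N1 N2] /= [yN1 xN2] NN].
  have [z [xz N1z]] := xy _ yN1.
  exists (z, x); split; last by apply: NN; split=> //=; exact: nbhs_singleton.
  by apply: subset_closure; exact: leaf_sym.
have leaf_closureE x y : leaf F x y -> closure (leaf F x) `<=` closure (leaf F y).
  by move=> xy; apply: closureS => z xz; apply: leaf_trans xz; exact: leaf_sym.
split; [by move=> x; apply: subset_closure; exact: leafxx | |exact: symR].
move=> x y z xy yz.
suff : closure (leaf F y) `<=` closure (leaf F x) by apply.
move=> u yu; have : closure (closure (leaf F x)) u.
  apply: (closureS _ yu) => v yv.
  exact: symR (leaf_closureE _ _ yv _ (symR _ _ xy)).
by rewrite -(closure_id _).1//; exact: closed_closure.
Qed.

Lemma minimal_or_compact_almost_periodic : hausdorff_space M ->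
  minimal_foliation F \/ compact_foliation F -> pointwise_almost_periodic F.
Proof.
move=> hM [minF|compF].
  have full x y : closure (leaf F x) y.
    move=> N /nbhs_interior/nbhs_singleton yN.
    have [u [Nu xu]] := minF x _ (ex_intro _ y yN) (@open_interior _ N).
    by exists u; split=> //; exact: interior_subset.
  by split=> x *; exact: full.
have leafE x : closure (leaf F x) = leaf F x.
  by rewrite -(closure_id _).1//; exact: compact_closed.
split=> [x|x y z|x y]; rewrite /closure_relation !leafE.
- exact: leafxx.
- exact: leaf_trans.
- exact: leaf_sym.
Qed.

End Leaves.

Theorem theorem5p2 (R : realType) (n : nat) (M : topologicalType)
    (manifold_M : manifold R n M)
    (compact_M : compact [set: M]) (connected_M : connected [set: M])
    (F : foliation R n M) (boundary_F : tangent_or_transverse F) :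
  [<-> pointwise_almost_periodic F;
       R_closed F;
       minimal_foliation F \/ compact_foliation F].
Proof.
have [hM _ _] := manifold_M; tfae.
- exact: almost_periodic_R_closed.
- by move/R_closed_almost_periodic; exact: almost_periodic_minimal_or_compact.
- exact: minimal_or_compact_almost_periodic.
Qed.
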